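(* For every function $f:\mathbb N\to\mathbb N$ there exist a finite configuration $A\subseteq\mathbb N^n$ and a Markov basis $M$ of $I_A$ such that $\deg_{Gr_A}>f(\deg_M)$, $\deg_{\mathcal U_A}>f(\deg_M)$ and $\deg_{\mathcal C_A}>f(\deg_M)$. That is, the degrees of the elements of the Graver basis, of the universal Gröbner basis and of the circuits of a toric ideal cannot be bounded above by any function of the maximal degree of the elements of a Markov basis.
   Context: Let $\mathbb K$ be a field and $A=\{\mathbf a_1,\dots,\mathbf a_m\}\subseteq\mathbb Z^n$ finite. For $\mathbf u\in\mathbb N^m$, $\mathbf x^{\mathbf u}=x_1^{u_1}\cdots x_m^{u_m}$ has degree $u_1+\dots+u_m$ and $A$-degree $\sum u_i\mathbf a_i$. The toric ideal $I_A\subseteq\mathbb K[x_1,\dots,x_m]$ is generated by all binomials $\mathbf x^{\mathbf u}-\mathbf x^{\mathbf v}$ of equal $A$-degree. The degree of a binomial is the maximum of the degrees of its two monomials. $Gr_A$ (Graver basis) is the set of primitive binomials: irreducible binomials $\mathbf x^{\mathbf u}-\mathbf x^{\mathbf v}\in I_A$ such that no other binomial $\mathbf x^{\mathbf w}-\mathbf x^{\mathbf z}\in I_A$ has $\mathbf x^{\mathbf w}\mid\mathbf x^{\mathbf u}$, $\mathbf x^{\mathbf z}\mid\mathbf x^{\mathbf v}$. $\mathcal U_A$ is the union of all reduced Gröbner bases of $I_A$. $\mathcal C_A$ is the set of circuits (irreducible nonzero binomials of $I_A$ of minimal support). A Markov basis is a generating set of $I_A$ of binomials minimal under inclusion. For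 a finite set $S$ of binomials, $\deg_S$ is the maximal degree of its elements. *)

(* Defs.v *)
From HB Require Import structures.
From mathcomp Require Import all_boot all_order all_algebra.
From mathcomp.multinomials Require Export mpoly.

Set Implicit Arguments.
Unset Strict Implicit.
Unset Printing Implicit Defensive.

Import GRing.Theory.
Local Open Scope ring_scope.

(* Sets of polynomials are Prop-valued predicates: membership in I_A, Gr_A,
   U_A and C_A comes with no decision procedure. *)

Section CommutativeAlgebra.

Variable R : idomainType.

Definition irreducible_elt (p : R) : Prop :=
  [/\ p != 0, p \isn't a GRing.unit
    & forall q r : R, p = q * r ->
        q \is a GRing.unit \/ r \is a GRing.unit].

Definition ideal_gen (S : R -> Prop) (p : R) : Prop :=
  exists2 s : seq (R * R),
    forall c, c \in s -> S c.2 & p = \sum_(c <- s) c.1 * c.2.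

End CommutativeAlgebra.

Section Polynomials.

Variables (K : fieldType) (m : nat).

Implicit Types (p q g : {mpoly K[m]}) (u v w z : 'X_{1..m}).
Implicit Types (S I : {mpoly K[m]} -> Prop) (le : rel 'X_{1..m}).

(* [msize] is one more than the largest degree of a monomial. *)
Definition pdeg p : nat := (msize p).-1.

(* [is_maxdeg S d] is "deg_S = d"; it can only hold when the degrees of the
   elements of S are bounded and S is nonempty. *)
Definition is_maxdeg S (d : nat) : Prop :=
  (exists2 p, S p & pdeg p = d) /\ (forall p, S p -> (pdeg p <= d)%N).

Definition monomial_order le : Prop :=
  [/\ total le, antisymmetric le, transitive le,
      forall u, le 0%MM u
    & forall u v w, le u v -> le (u + w)%MM (v + w)%MM].

Definition is_initial le p u : Prop :=
  u \in msupp p /\ (forall v, v \in msupp p -> le v u).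

Definition initial_monomials le S q : Prop :=
  exists p u, [/\ S p, is_initial le p u & q = 'X_[u]].

Definition groebner_basis le I (G : seq {mpoly K[m]}) : Prop :=
  (forall g, g \in G -> I g) /\
  (forall q, ideal_gen (initial_monomials le (fun g => g \in G)) q <->
             ideal_gen (initial_monomials le I) q).

(* The second clause also forces 0 out of G and makes the set of initial
   monomials of G a minimal generating set of the initial ideal. *)
Definition reduced_groebner_basis le I (G : seq {mpoly K[m]}) : Prop :=
  [/\ groebner_basis le I G,
      forall g, g \in G -> exists2 u, is_initial le g u & g@_u = 1
    & forall g g' u v, g \in G -> g' \in G -> g != g' ->
        is_initial le g u -> v \in msupp g' -> ~~ (u <= v)%MM].

Definition universal_groebner I p : Prop :=
  exists le G,
    [/\ monomial_order le, reduced_groebner_basis le I G & p \in G].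

Definition mbinomial u v : {mpoly K[m]} := 'X_[u] - 'X_[v].

Definition is_binomial p : Prop := exists u v, p = mbinomial u v.

Definition var_support p : {set 'I_m} :=
  [set i | has (fun u : 'X_{1..m} => u i != 0%N) (msupp p)].

(* The zero binomial (w = z) lies in every ideal and is not to be counted
   among the binomials dividing a given one. *)
Definition graver I p : Prop :=
  exists u v, [/\ p = mbinomial u v, irreducible_elt p, I p
    & forall w z, w != z -> I (mbinomial w z) ->
        (w <= u)%MM -> (z <= v)%MM -> (w, z) = (u, v)].

Definition circuit I p : Prop :=
  [/\ is_binomial p, irreducible_elt p, I p
    & forall q, is_binomial q -> q != 0 -> I q ->
        ~~ (var_support q \proper var_support p)].

Definition binomial_generating_set I S : Prop :=
  (forall p, S p -> is_binomial p) /\ (forall p, ideal_gen S p <-> I p).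

Definition markov_basis I S : Prop :=
  binomial_generating_set I S /\
  (forall T : {mpoly K[m]} -> Prop, (forall p, T p -> S p) ->
     binomial_generating_set I T -> forall p, S p -> T p).

End Polynomials.

Definition adeg (m n : nat) (A : 'I_m -> 'rV[int]_n) (u : 'X_{1..m}) :
  'rV[int]_n := \sum_(i < m) A i *+ u i.

Definition toric_ideal (K : fieldType) (m n : nat) (A : 'I_m -> 'rV[int]_n) :
  {mpoly K[m]} -> Prop :=
  ideal_gen (fun p => exists u v, adeg A u = adeg A v /\ p = mbinomial K u v).

Arguments toric_ideal K {m n} A _.

(* Main.v *)
Require Import Defs.
From HB Require Import structures.
From mathcomp Require Import all_boot all_order all_algebra.
From mathcomp.multinomials Require Import mpoly.

(* With the weights 1, 2, 4, ..., 2^k the toric ideal is generated by the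
   quadratic binomials x_{i+1} - x_i^2, whatever k is, whereas eliminating the
   intermediate variables yields x_k - x_0^(2^k). The degree 2^k is also the
   largest possible: because each weight divides the next one, any monomial of
   weight at least 2^k has a divisor of weight exactly 2^k, so a binomial of
   weight larger than 2^k splits. *)

Set Implicit Arguments.
Unset Strict Implicit.
Unset Printing Implicit Defensive.

Import Order.TTheory GRing.Theory Num.Theory.

Local Open Scope ring_scope.

(** * Ideals generated by a set *)

Section IdealGen.

Variable R : idomainType.
Implicit Types (S T : R -> Prop) (p q : R).

Lemma ideal_gen_mem S p : S p -> ideal_gen S p.
Proof.
move=> Sp; exists [:: (1, p)]; last by rewrite big_seq1 mul1r.
by move=> c; rewrite inE => /eqP->.
Qed.

Lemma ideal_gen0 S : ideal_gen S 0.
Proof. by exists [::]; rewrite ?big_nil. Qed.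

Lemma ideal_genD S p q : ideal_gen S p -> ideal_gen S q -> ideal_gen S (p + q).
Proof.
move=> [s Ss ->] [t St ->]; exists (s ++ t); last by rewrite big_cat.
by move=> c; rewrite mem_cat => /orP[/Ss|/St].
Qed.

Lemma ideal_genM S a p : ideal_gen S p -> ideal_gen S (a * p).
Proof.
move=> [s Ss ->]; exists [seq (a * c.1, c.2) | c <- s].
  by move=> _ /mapP[c /Ss Sc ->].
by rewrite big_map mulr_sumr; apply: eq_bigr => c _; rewrite mulrA.
Qed.

Lemma ideal_genN S p : ideal_gen S p -> ideal_gen S (- p).
Proof. by rewrite -mulN1r; apply: ideal_genM. Qed.

Lemma ideal_gen_min S T p :
  (forall q, S q -> ideal_gen T q) -> ideal_gen S p -> ideal_gen T p.
Proof.
move=> sST [s Ss ->]; elim: s Ss => [|c s IHs] Ss.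
  by rewrite big_nil; apply: ideal_gen0.
rewrite big_cons; apply: ideal_genD.
  by apply/ideal_genM/sST/Ss; rewrite mem_head.
by apply: IHs => d sd; apply: Ss; rewrite inE sd orbT.
Qed.

(** Source of necessary conditions for membership, applied below to a substitution into polynomials
    in one variable. *)
Lemma ideal_gen_rmorph0 (R' : nzRingType) (h : {rmorphism R -> R'}) S p :
  (forall q, S q -> h q = 0) -> ideal_gen S p -> h p = 0.
Proof.
move=> hS [s Ss ->]; rewrite rmorph_sum big_seq big1 // => c /Ss/hS hc.
by rewrite rmorphM hc mulr0.
Qed.

End IdealGen.

(** * Binomials, monomial ideals and substitutions *)

Section Binomials.

Variables (K : fieldType) (m : nat).
Implicit Types (p q : {mpoly K[m]}) (u v w z : 'X_{1..m}) (i j : 'I_m).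

Lemma lem_antisym u v : (u <= v)%MM -> (v <= u)%MM -> u = v.
Proof.
move=> /mnm_lepP le_uv /mnm_lepP le_vu.
by apply/mnmP => i; apply/anti_leq; rewrite le_uv le_vu.
Qed.

Lemma mnm_single u i : (forall j, j != i -> u j = 0%N) -> u = (U_(i) *+ u i)%MM.
Proof.
move=> u0; apply/mnmP => j; rewrite mulmnE mnm1E eq_sym.
by have [->|/u0->] := eqVneq j i; rewrite ?mul1n.
Qed.

Lemma mbinomial_eq0 u v : (mbinomial K u v == 0) = (u == v).
Proof.
apply/eqP/eqP => [/(congr1 (mcoeff v))|->]; last exact: subrr.
rewrite mcoeffB !mcoeffX mcoeff0 eqxx; case: eqP => // _ /eqP.
by rewrite sub0r oppr_eq0 oner_eq0.
Qed.

Lemma mem_msupp_mbinomial u v w : u != v ->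
  (w \in msupp (mbinomial K u v)) = (w == u) || (w == v).
Proof.
move=> neq_uv; rewrite mcoeff_msupp mcoeffB !mcoeffX !(eq_sym w).
case: (eqVneq u w) => [<-|_].
  by move: neq_uv; rewrite eq_sym => /negPf->; rewrite subr0 oner_eq0.
by case: (v == w); rewrite ?subr0 ?sub0r ?oppr_eq0 ?oner_eq0 ?eqxx.
Qed.

Lemma mbinomialDl w u v :
  mbinomial K (w + u) (w + v) = 'X_[w] * mbinomial K u v.
Proof. by rewrite /mbinomial !mpolyXD mulrBr. Qed.

Lemma pdeg_le p d :
  (forall v, v \in msupp p -> (mdeg v <= d)%N) -> (pdeg p <= d)%N.
Proof.
move=> le_p_d; have : (msize p <= d.+1)%N.
  by rewrite msizeE; apply/bigmax_leqP_seq => v /le_p_d.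
by rewrite /pdeg; case: (msize p).
Qed.

Lemma pdeg_mbinomial u v : u != v ->
  pdeg (mbinomial K u v) = maxn (mdeg u) (mdeg v).
Proof.
move=> neq_uv; apply/eqP; rewrite eqn_leq geq_max; apply/andP; split.
  apply: pdeg_le => w; rewrite mem_msupp_mbinomial // leq_max.
  by case/orP=> /eqP->; rewrite leqnn ?orbT.
have le_pdeg w : w \in msupp (mbinomial K u v) ->
    (mdeg w <= pdeg (mbinomial K u v))%N.
  by move/msize_mdeg_lt; rewrite /pdeg; case: (msize _).
by rewrite !le_pdeg // mem_msupp_mbinomial // eqxx ?orbT.
Qed.

(** A monomial of a sum occurs in some summand, and every monomial of a multiple of ['X_[u]] is
    divisible by ['X_[u]]. *)
Lemma mem_monomial_ideal (S : {mpoly K[m]} -> Prop) w :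
    (forall q, S q -> exists u, q = 'X_[u]) -> ideal_gen S 'X_[w] ->
  exists2 u, S 'X_[u] & (u <= w)%MM.
Proof.
move=> monS [s Ss def_w]; have: w \in msupp ('X_[w] : {mpoly K[m]}).
  by rewrite msuppX mem_head.
rewrite def_w => /msupp_sum_le /flattenP[t /mapP[c]].
rewrite filter_predT => /Ss Sc -> /msuppM_le /allpairsP[[w1 w2] /= [_]].
have [u def_c] := monS _ Sc; rewrite def_c msuppX inE => /eqP-> ->.
by exists u; [rewrite -def_c | apply: lem_addl].
Qed.

Lemma unit_mpolyC (c : K) : c != 0 -> (c%:MP : {mpoly K[m]}) \is a GRing.unit.
Proof.
move=> nz_c; apply/unitrP; exists (c^-1)%:MP.
by rewrite -!mpolyCM mulVf ?mulfV.
Qed.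

Lemma mpolyX_unit u : ('X_[u] : {mpoly K[m]}) \is a GRing.unit -> u = 0%MM.
Proof.
case/andP=> _; rewrite mcoeffX unitfE; case: (eqVneq u 0%MM) => // _.
by rewrite eqxx.
Qed.

Lemma mem_var_support u v i : u != v ->
  (i \in var_support (mbinomial K u v)) = (u i != 0%N) || (v i != 0%N).
Proof.
move=> neq_uv; rewrite inE; apply/hasP/orP => [[w]|].
  by rewrite mem_msupp_mbinomial // => /predU1P[->|/eqP->]; [left | right].
by case=> nz; [exists u | exists v]; rewrite // mem_msupp_mbinomial ?eqxx ?orbT.
Qed.

Lemma is_initial_inj (le : rel 'X_{1..m}) p u u' : antisymmetric le ->
  is_initial le p u -> is_initial le p u' -> u = u'.
Proof.
by move=> anti [p_u max_u] [p_u' max_u']; apply: anti; rewrite max_u ?max_u'.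
Qed.

Lemma comp_mpoly_var (s : m.-tuple {mpoly K[m]}) i : 'X_i \mPo s = tnth s i.
Proof. by rewrite comp_mpolyXU -tnth_nth. Qed.

(** Substitution is a ring morphism, so invertibility of a change of variables is checked on the
    variables. *)
Lemma comp_mpolyK (s t : m.-tuple {mpoly K[m]}) p :
  (forall i, tnth s i \mPo t = 'X_i) -> (p \mPo s) \mPo t = p.
Proof.
move=> stK; rewrite [p in RHS]mpolyE [p \mPo s]comp_mpolyE raddf_sum.
apply: eq_bigr => v _; rewrite /= comp_mpolyZ mpolyXE_id rmorph_prod; congr (_ *: _).
by apply: eq_bigr => i _; rewrite rmorphXn /= stK.
Qed.

End Binomials.

(** * Monomials graded by powers of two *)

Section PowersOfTwo.

Variables (K : fieldType) (k : nat).
Implicit Types (p q : {mpoly K[k.+1]}) (u v w z : 'X_{1..k.+1}).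
Implicit Types (i j : 'I_k.+1).

(** The [A]-degree for [powers2], kept as a natural number so that divisibility and subtraction are
    at hand. *)
Definition wt u : nat := \sum_i u i * 2 ^ i.

Lemma wt0 : wt 0%MM = 0%N.
Proof. by rewrite /wt big1 // => i _; rewrite mnm0E. Qed.

Lemma wtD u v : wt (u + v)%MM = (wt u + wt v)%N.
Proof.
by rewrite /wt -big_split; apply: eq_bigr => i _; rewrite mnmDE mulnDl.
Qed.

Lemma wt1 i : wt U_(i)%MM = (2 ^ i)%N.
Proof.
rewrite /wt (bigD1 i) //= mnm1E eqxx mul1n big1 ?addn0 // => j neq_ji.
by rewrite mnm1E eq_sym (negPf neq_ji).
Qed.

Lemma wtMn u e : wt (u *+ e)%MM = (wt u * e)%N.
Proof.
elim: e => [|e IHe]; first by rewrite mulm0n wt0 muln0.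
by rewrite mulmS wtD IHe mulnS.
Qed.

Lemma wtB u w : (w <= u)%MM -> wt (u - w)%MM = (wt u - wt w)%N.
Proof. by move=> /submK {2}<-; rewrite wtD addnK. Qed.

(** All weights are at least 1. This turns the bounds on weights below into bounds on degrees. *)
Lemma mdeg_le_wt u : (mdeg u <= wt u)%N.
Proof. by rewrite mdegE; apply: leq_sum => i _; rewrite leq_pmulr ?expn_gt0. Qed.

Lemma wt_eq0 u : (wt u == 0%N) = (u == 0%MM).
Proof.
apply/idP/eqP=> [wt_u|->]; last by rewrite wt0.
by apply/eqP; rewrite -mdeg_eq0 -leqn0 -(eqP wt_u) mdeg_le_wt.
Qed.

Lemma le_wt w u : (w <= u)%MM -> (wt w <= wt u)%N.
Proof. by move/submK <-; rewrite wtD leq_addl. Qed.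

Lemma wt_le_inj w u : (w <= u)%MM -> wt w = wt u -> w = u.
Proof.
move=> le_wu eq_wt; have := wtB le_wu; rewrite eq_wt subnn => /eqP.
by rewrite wt_eq0 => /eqP uw0; rewrite -(submK le_wu) uw0 add0m.
Qed.

(* Remove a variable of least index as long as the weight exceeds 2^k: the
   weight stays a multiple of the removed 2^i, so it cannot jump over 2^k. *)
Lemma submonomial_wt u : (2 ^ k <= wt u)%N ->
  exists2 w, (w <= u)%MM & wt w = (2 ^ k)%N.
Proof.
have [n] := ubnP (wt u); elim: n u => // n IHn u /ltnSE-le_u_n.
rewrite leq_eqVlt => /predU1P[eq_wt|lt_wt].
  by exists u; rewrite ?lepm_refl.
have /existsP[i0 u_i0] : [exists i, u i != 0%N].
  apply/contraTT: lt_wt => /existsPn u0; rewrite -leqNgt.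
  suff -> : u = 0%MM by rewrite wt0.
  by apply/mnmP => i; rewrite mnm0E; apply/eqP; rewrite -[_ == _]negbK u0.
pose index (i : 'I_k.+1) : nat := i.
case: (arg_minnP (P := fun i => u i != 0%N) index u_i0) => i u_i min_i.
have dvd_i (j : nat) : (i <= j)%N -> (2 ^ i %| 2 ^ j)%N by apply: dvdn_exp2l.
have dvd_u : (2 ^ i %| wt u)%N.
  apply: dvdn_sum => j _; have [->|/min_i/dvd_i] := eqVneq (u j) 0%N.
    by rewrite mul0n.
  exact: dvdn_mull.
have le_Ui : (U_(i) <= u)%MM by rewrite lep1mP.
have wt_u' : wt (u - U_(i))%MM = (wt u - 2 ^ i)%N by rewrite wtB ?wt1.
have pos_i : (0 < 2 ^ i)%N by rewrite expn_gt0.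
have [||w le_w wt_w] := IHn (u - U_(i))%MM.
- rewrite wt_u' (leq_trans _ le_u_n) // ltn_subrL pos_i.
  exact: leq_ltn_trans lt_wt.
- rewrite wt_u'; have /dvdnP[a def_a] := dvd_u.
  have /dvdnP[b def_b] := dvd_i k (ltn_ord i).
  move: lt_wt; rewrite def_a def_b ltn_pmul2r // => lt_ba.
  rewrite leq_subRL -?mulSn ?leq_pmul2r // leq_pmull //.
  exact: leq_ltn_trans lt_ba.
by exists w => //; apply: lepm_trans le_w (lem_subr _ _).
Qed.

(** Take divisors of [u] and [v] of weight exactly [2 ^ k]. If they differ, they are the pair; if
    they coincide, the two cofactors are, and these differ because [u] and [v] do. *)
Lemma proper_balanced_pair u v :
    (2 ^ k < wt u)%N -> wt u = wt v -> u != v ->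
  exists w z, [/\ (w <= u)%MM, (z <= v)%MM, wt w = wt z & w != z] /\
    (w != u /\ z != v).
Proof.
move=> lt_u eq_wt neq_uv; have lt_v : (2 ^ k < wt v)%N by rewrite -eq_wt.
have [w le_wu wt_w] := submonomial_wt (ltnW lt_u).
have [z le_zv wt_z] := submonomial_wt (ltnW lt_v).
have neq_w t t' : wt t != wt t' -> t != t' by apply: contraNneq => ->.
have pos_k : (0 < 2 ^ k)%N by rewrite expn_gt0.
have [eq_wz|neq_wz] := eqVneq w z; last first.
  exists w, z; split; first by rewrite wt_w wt_z.
  by split; apply: neq_w; rewrite ?wt_w ?wt_z ltn_eqF.
exists (u - w)%MM, (v - z)%MM; split.
  split; rewrite ?lem_subr // ?wtB ?wt_w ?wt_z ?eq_wt //.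
  apply: contraNneq neq_uv => eq_sub.
  by rewrite -(submK le_wu) eq_sub eq_wz submK.
split; apply: neq_w; rewrite wtB // neq_ltn ltn_subrL ?wt_w ?wt_z pos_k /=.
  by rewrite (leq_ltn_trans _ lt_u).
by rewrite (leq_ltn_trans _ lt_v).
Qed.

(** * The toric ideal of the powers of two *)

Definition powers2 (i : 'I_k.+1) : 'rV[int]_1 := const_mx (2 ^ i)%:Z.

Local Notation I := (toric_ideal K powers2).

Lemma adeg_powers2 u : adeg powers2 u = const_mx (wt u)%:Z.
Proof.
apply/matrixP => a b; rewrite /adeg summxE mxE /wt (big_morph Posz PoszD erefl).
by apply: eq_bigr => i _; rewrite mulmxnE mxE PoszM mulrC -mulr_natr natz.
Qed.

Lemma toric_mbinomial u v : wt u = wt v -> I (mbinomial K u v).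
Proof.
by move=> eq_wt; apply: ideal_gen_mem; exists u, v; rewrite !adeg_powers2 eq_wt.
Qed.

(** Substituting ['X^(2 ^ i)] for the variable of index [i] kills the ideal. The coefficient of
    degree [wt v] in the image is the sum of the coefficients of [p] in weight [wt v]; it vanishes,
    so [v] is not alone in its weight. *)
Lemma toric_balanced p v : I p -> v \in msupp p ->
  exists2 v', v' \in msupp p & v' != v /\ wt v' = wt v.
Proof.
move=> Ip supp_v; pose h i : {poly K} := 'X^(2 ^ i).
have hX u : mmap (@polyC K) h 'X_[u] = 'X^(wt u).
  rewrite mmapX /mmap1 /wt expr_sum; apply: eq_bigr => i _.
  by rewrite /h -exprM mulnC.
have /(congr1 (fun r : {poly K} => r`_(wt v))) : mmap (@polyC K) h p = 0.
  apply: ideal_gen_rmorph0 Ip => _ [u [w [eq_deg ->]]].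
  rewrite rmorphB /= !hX; suff -> : wt u = wt w by rewrite subrr.
  by move: eq_deg; rewrite !adeg_powers2 => /matrixP/(_ 0 0); rewrite !mxE => -[].
rewrite coef0 {1}[p]mpolyE raddf_sum coef_sum => sum0.
have [/hasP[v' p_v' /andP[neq eq_wt]]|/hasPn noV] :=
    boolP (has (fun v' => (v' != v) && (wt v' == wt v)) (msupp p)).
  by exists v' => //; split=> //; apply/eqP.
suff /negP[] : v \notin msupp p by [].
rewrite -mcoeff_eq0 -[X in _ == X]sum0.
rewrite (bigD1_seq v) //= ?msupp_uniq // mmapZ hX coefCM coefXn eqxx mulr1.
rewrite big_seq_cond big1 ?addr0 // => w /andP[/noV noVw neq_wv].
rewrite mmapZ hX coefCM coefXn eq_sym; move: noVw; rewrite neq_wv /=.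
by move/negPf->; rewrite mulr0.
Qed.

(** In a binomial the partner of [u] given by [toric_balanced] can only be [v]. *)
Lemma toric_mbinomialE u v : I (mbinomial K u v) <-> wt u = wt v.
Proof.
split=> [Iuv|]; last exact: toric_mbinomial.
have [->//|neq_uv] := eqVneq u v.
have [|v' + []] := toric_balanced (v := u) Iuv.
  by rewrite mem_msupp_mbinomial ?eqxx.
by rewrite mem_msupp_mbinomial // => /predU1P[->|/eqP->//]; rewrite eqxx.
Qed.

Lemma toric_one : ~ I 1.
Proof.
move=> /toric_balanced-/(_ 0%MM); rewrite msupp1 mem_head => /(_ isT)[v'].
by rewrite inE => /eqP-> []; rewrite eqxx.
Qed.

(** * Degree bounds for the Graver and universal Groebner bases *)

Lemma graver_pdeg_le p : graver I p -> (pdeg p <= 2 ^ k)%N.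
Proof.
case=> u [v [-> [nz_p _ _] /toric_mbinomialE eq_wt prim]].
have neq_uv : u != v by rewrite -(mbinomial_eq0 K).
(* A weight of at most [2 ^ k] bounds the degree; beyond it, a proper balanced pair violates
   primitivity. *)
have [le_wt|lt_wt] := leqP (wt u) (2 ^ k).
  rewrite pdeg_mbinomial // geq_max (leq_trans (mdeg_le_wt u)) //.
  by rewrite (leq_trans (mdeg_le_wt v)) // -eq_wt.
have [w [z [[le_w le_z eq_wz neq_wz] [neq_wu _]]]] :=
  proper_balanced_pair lt_wt eq_wt neq_uv.
have [eq_wu _] := prim w z neq_wz (toric_mbinomial eq_wz) le_w le_z.
by rewrite eq_wu eqxx in neq_wu.
Qed.

(** Each weight contains at most one monomial outside the initial ideal. Reducedness puts the tail
    of [p] and the proper divisors of its initial monomial there, so a proper balanced pair cannot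
    exist. *)
Lemma universal_groebner_pdeg_le p :
  universal_groebner I p -> (pdeg p <= 2 ^ k)%N.
Proof.
case=> le [G [[tot anti trans le0 leD] [[GI inG] monic red] Gp]].
have [u lead_u _] := monic _ Gp; have [p_u max_u] := lead_u.
(* Since [G] is a Groebner basis, these are the monomials outside the initial ideal. *)
pose standard w := forall g u', g \in G -> is_initial le g u' -> ~~ (u' <= w)%MM.
have std_tail v z : v \in msupp p -> v != u -> (z <= v)%MM -> standard z.
  move=> p_v neq_vu le_zv g u' Gg lead_u'; apply: contraNN neq_vu => le_u'z.
  have le_u'v := lepm_trans le_u'z le_zv.
  have [eq_gp|neq_gp] := eqVneq g p; last first.
    by case/negP: (red _ _ _ _ Gg Gp neq_gp lead_u' p_v).
  rewrite eq_gp in lead_u'; rewrite -(is_initial_inj anti lead_u lead_u') in le_u'v.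
  (* A multiple of the initial monomial is at least as large in the order, so it cannot occur in the
     tail. *)
  apply/eqP/anti; rewrite max_u //= -(submK le_u'v).
  by have := leD _ _ u (le0 (v - u)%MM); rewrite add0m.
have std_proper w : (w <= u)%MM -> w != u -> standard w.
  move=> le_wu neq_wu g u' Gg lead_u'; apply: contraNN neq_wu => le_u'w.
  have [eq_gp|neq_gp] := eqVneq g p; last first.
    by case/negP: (red _ _ _ _ Gg Gp neq_gp lead_u' p_u); apply: lepm_trans le_wu.
  rewrite eq_gp in lead_u'; rewrite -(is_initial_inj anti lead_u lead_u') in le_u'w.
  by rewrite (lem_antisym le_wu le_u'w).
(* Otherwise the binomial of the two lies in the ideal, and its initial monomial is the larger of
   them, which is standard. *)
have std_inj w z : standard w -> standard z -> wt w = wt z -> w = z.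
  move=> std_w std_z eq_wt; apply/eqP/negPn/negP => neq_wz.
  wlog le_zw : w z std_w std_z eq_wt neq_wz / le z w.
    move=> wlog_le; case/orP: (tot z w) => [le_zw|le_wz].
      exact: (wlog_le w z).
    by apply: (wlog_le z w) => //; rewrite eq_sym.
  have lead_w : is_initial le (mbinomial K w z) w.
    split=> [|v]; rewrite mem_msupp_mbinomial ?eqxx // => /predU1P[->|/eqP->//].
    by case/orP: (tot w w).
  have /inG/mem_monomial_ideal : ideal_gen (initial_monomials le I) 'X_[w].
    by apply: ideal_gen_mem; exists (mbinomial K w z), w; split=> //;
       apply: toric_mbinomial.
  case=> [_ [g [u' [_ _ ->]]]|u' [g [u'' [Gg lead_u'' eq_u']]] le_u'w].
    by exists u'.
  have eq_u : u' = u''.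
    have /mem_msuppXP : u' \in msupp ('X_[u''] : {mpoly K[k.+1]}).
      by rewrite -eq_u' msuppX mem_head.
    by [].
  by case/negP: (std_w _ _ Gg lead_u''); rewrite -eq_u.
(* A tail monomial has a partner of equal weight in [p]; by [std_inj] the partner is not in the
   tail, hence it is [u]. *)
have wt_p v : v \in msupp p -> wt v = wt u.
  move=> p_v; have [->//|neq_vu] := eqVneq v u.
  have [v' p_v' [neq_v' eq_wt]] := toric_balanced (GI _ Gp) p_v.
  have [<-//|neq_v'u] := eqVneq v' u.
  case/eqP: neq_v'; apply: std_inj eq_wt; apply: std_tail (lepm_refl _) => //.
have le_u : (wt u <= 2 ^ k)%N.
  rewrite leqNgt; apply/negP => lt_u.
  have [v p_v [neq_vu eq_wt]] := toric_balanced (GI _ Gp) p_u.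
  have [||w [z [[le_w le_z eq_wz neq_wz] [neq_wu _]]]] :=
    proper_balanced_pair (v := v) lt_u; rewrite 1?eq_sym //.
  case/eqP: neq_wz; apply: std_inj eq_wz; first exact: std_proper.
  exact: std_tail le_z.
apply: pdeg_le => v /wt_p eq_wt.
by rewrite (leq_trans (mdeg_le_wt v)) ?eq_wt.
Qed.

(** * Irreducible binomials and the degree bound for circuits *)

Lemma toric_nonunit p : I p -> p \isn't a GRing.unit.
Proof.
move=> Ip; apply/negP => Up; apply: toric_one.
by rewrite -(mulVr Up); apply: ideal_genM.
Qed.

(** A common variable factors out; it is not a unit, and neither is the cofactor, which lies in the
    proper ideal [I]. *)
Lemma irreducible_mbinomial_coprime u v i :
  irreducible_elt (mbinomial K u v) -> wt u = wt v -> u i != 0%N -> v i = 0%N.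
Proof.
case=> _ _ irr eq_wt; rewrite -lep1mP => le_u; apply/eqP; rewrite -[_ == _]negbK.
apply/negP; rewrite -lep1mP => le_v.
have def_p : mbinomial K u v =
    'X_i * mbinomial K (u - U_(i))%MM (v - U_(i))%MM.
  by rewrite -mbinomialDl ![(U_(i) + _)%MM]addmC !submK.
have [/mpolyX_unit/eqP|] := irr _ _ def_p; first by rewrite mnm1_eq0.
by apply/negP/toric_nonunit/toric_mbinomial; rewrite !wtB ?eq_wt.
Qed.

(** For [e] at least 2 the difference of [e]-th powers splits off [mbinomial K u v]. The other
    factor has only terms of positive weight, hence zero constant coefficient, and is no unit
    either. *)
Lemma irreducible_mbinomial_primitive u v e :
    irreducible_elt (mbinomial K (u *+ e) (v *+ e)) -> wt u = wt v ->
    wt u != 0%N -> e = 1%N.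
Proof.
case: e => [|[|e]] // [nz_p _ irr] eq_wt nz_u.
  by rewrite mbinomial_eq0 !mulm0n eqxx in nz_p.
have := irr (mbinomial K u v) _ _; rewrite /mbinomial -!mpolyXn subrXX.
case/(_ _ erefl) => [|/andP[_]].
  by move/negP: (toric_nonunit (toric_mbinomial eq_wt)).
rewrite raddf_sum big1 ?unitr0 // => i _.
have le_ie : (i <= e.+1)%N by rewrite -ltnS.
rewrite !mpolyXn -mpolyXD /= mcoeffX -wt_eq0 wtD !wtMn -eq_wt -mulnDr.
by rewrite (subnK le_ie) muln_eq0 (negPf nz_u).
Qed.

Lemma mnm_neq0 u : wt u != 0%N -> exists i, u i != 0%N.
Proof.
move=> nz_u; apply/existsP; apply: contraNT nz_u => /existsPn u0.
rewrite wt_eq0; apply/eqP/mnmP => i; rewrite mnm0E; apply/eqP.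
by rewrite -[_ == _]negbK u0.
Qed.

(** Any two variables already carry a binomial of the ideal, so a circuit involves exactly two;
    irreducibility then leaves the smallest exponents that balance the weights. *)
Lemma circuit_pdeg_le p : circuit I p -> (pdeg p <= 2 ^ k)%N.
Proof.
case=> -[u [v ->]] irr /toric_mbinomialE eq_wt min_p.
have neq_uv : u != v by case: irr; rewrite mbinomial_eq0.
have nz_u : wt u != 0%N.
  apply: contraNN neq_uv => u0; have := u0; rewrite eq_wt.
  by move: u0; rewrite !wt_eq0 => /eqP-> /eqP->.
have [i u_i] := mnm_neq0 nz_u.
have v_i := irreducible_mbinomial_coprime irr eq_wt u_i.
have [|j v_j] := @mnm_neq0 v; first by rewrite -eq_wt.
have u_j : u j = 0%N.
  apply/eqP; apply: contraTT v_j => u_j.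
  by rewrite negbK (irreducible_mbinomial_coprime irr eq_wt).
have neq_ij : i != j by apply: contraNneq u_i => ->; rewrite u_j.
(* Subtraction is truncated, so the exponent at the larger index is 1 and both powers have weight
   [2 ^ maxn i j]. *)
pose a := (2 ^ (j - i))%N; pose b := (2 ^ (i - j))%N.
have pos_a : (0 < a)%N by rewrite expn_gt0.
have pos_b : (0 < b)%N by rewrite expn_gt0.
have eq_ab : wt (U_(i) *+ a)%MM = wt (U_(j) *+ b)%MM.
  by rewrite !wtMn !wt1 -!expnD -!maxnE maxnC.
have neq_ab : (U_(i) *+ a != U_(j) *+ b)%MM.
  apply/eqP => /mnmP/(_ i); rewrite !mulmnE !mnm1E eqxx eq_sym (negPf neq_ij).
  by rewrite mul1n => a0; rewrite a0 in pos_a.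
(* The test binomial has its support inside that of the circuit; minimality makes the inclusion an
   equality. *)
have supp_ij l : l \in var_support (mbinomial K u v) -> (l == i) || (l == j).
  have supp_q l' : l' \in var_support (mbinomial K (U_(i) *+ a) (U_(j) *+ b)) ->
      (l' == i) || (l' == j).
    rewrite mem_var_support // !mulmnE !mnm1E ![_ == l']eq_sym.
    by case: (l' == i); case: (l' == j).
  move=> p_l; apply: (supp_q); move: l p_l; apply/subsetP.
  have := min_p (mbinomial K (U_(i) *+ a) (U_(j) *+ b)).
  rewrite properE negb_and negbK mbinomial_eq0 => /(_ _ neq_ab).
  case/(_ _ _)/orP => [||/negP[]|//].
  - by exists (U_(i) *+ a)%MM, (U_(j) *+ b)%MM.
  - exact: toric_mbinomial.
  apply/subsetP => l /supp_q; rewrite mem_var_support //.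
  by case/orP=> /eqP->; rewrite ?u_i ?v_j ?orbT.
have def_u : u = (U_(i) *+ u i)%MM.
  apply: mnm_single => l neq_li; apply/eqP; rewrite -[_ == _]negbK.
  apply/negP => u_l; have := supp_ij l; rewrite mem_var_support // u_l.
  by rewrite (negPf neq_li) => /(_ isT)/eqP eq_lj; rewrite eq_lj u_j in u_l.
have def_v : v = (U_(j) *+ v j)%MM.
  apply: mnm_single => l neq_lj; apply/eqP; rewrite -[_ == _]negbK.
  apply/negP => v_l; have := supp_ij l; rewrite mem_var_support // v_l.
  rewrite (negPf neq_lj) orbT orbF => /(_ isT)/eqP eq_li.
  by rewrite eq_li v_i in v_l.
(* The multiplier [e] is the exponent at the larger index, where [a] or [b] is 1. *)
have [e [def_ui def_vj]] : exists e, (u i = a * e /\ v j = b * e)%N.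
  have eq_uv : (u i * 2 ^ i = v j * 2 ^ j)%N.
    by move: eq_wt; rewrite {1}def_u {1}def_v !wtMn !wt1 ![(2 ^ _ * _)%N]mulnC.
  have pow_split x y : (x <= y)%N -> (2 ^ y = 2 ^ (y - x) * 2 ^ x)%N.
    by move=> le_xy; rewrite -expnD subnK.
  rewrite /a /b; case/orP: (leq_total i j) => le_ij.
    exists (v j); split; last by rewrite (eqP le_ij) mul1n.
    apply/eqP; rewrite -(eqn_pmul2r (m := 2 ^ i)) ?expn_gt0 // eq_uv.
    by rewrite (pow_split _ _ le_ij) mulnA [(v j * _)%N]mulnC.
  exists (u i); split; first by rewrite (eqP le_ij) mul1n.
  apply/eqP; rewrite -(eqn_pmul2r (m := 2 ^ j)) ?expn_gt0 // -eq_uv.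
  by rewrite (pow_split _ _ le_ij) mulnA [(u i * _)%N]mulnC.
have mulm_assoc (l : 'I_k.+1) c : (U_(l) *+ (c * e) = U_(l) *+ c *+ e)%MM.
  by apply/mnmP => l'; rewrite !mulmnE mulnA.
have nz_ab : wt (U_(i) *+ a)%MM != 0%N.
  by rewrite wtMn wt1 -lt0n muln_gt0 expn_gt0.
rewrite def_ui mulm_assoc in def_u; rewrite def_vj mulm_assoc in def_v.
have e1 : e = 1%N.
  by apply: irreducible_mbinomial_primitive eq_ab nz_ab; rewrite -def_u -def_v.
rewrite pdeg_mbinomial // def_u def_v e1 !mulm1n !mdegMn !mdeg1 !mul1n geq_max.
by rewrite !leq_pexp2l // (leq_trans (leq_subr _ _)) // -ltnS.
Qed.

(** * A Markov basis of quadratic binomials *)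

Definition doubling (i : 'I_k) : {mpoly K[k.+1]} :=
  mbinomial K U_(lift ord0 i) (U_(widen_ord (leqnSn k) i) *+ 2).

Definition doublings p : Prop := exists i : 'I_k, p = doubling i.

Lemma toric_doubling (i : 'I_k) : I (doubling i).
Proof. by apply: toric_mbinomial; rewrite wtMn !wt1 expnS mulnC. Qed.

(** Modulo the doublings every monomial becomes a power of the variable [ord0]; the doublings
    preserve weight, so the exponent is [wt w]. Congruence respects products, which leaves the
    single variables to be treated. *)
Lemma doublings_reduce w :
  ideal_gen doublings (mbinomial K w (U_(ord0) *+ wt w)).
Proof.
pose congr u v := ideal_gen doublings (mbinomial K u v).
have congr_refl u : congr u u.
  by rewrite /congr /mbinomial subrr; apply: ideal_gen0.
have congr_trans u v z : congr u v -> congr v z -> congr u z.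
  rewrite /congr => uv vz.
  have -> : mbinomial K u z = mbinomial K u v + mbinomial K v z.
    by rewrite /mbinomial addrA subrK.
  exact: ideal_genD.
have congrD u v u' v' : congr u v -> congr u' v' ->
    congr (u + u')%MM (v + v')%MM.
  move=> uv uv'; apply: (@congr_trans _ (v + u')%MM).
    by rewrite ![(_ + u')%MM]addmC /congr mbinomialDl; apply: ideal_genM.
  by rewrite /congr mbinomialDl; apply: ideal_genM.
have mulmDn (u : 'X_{1..k.+1}) a b : (u *+ (a + b) = u *+ a + u *+ b)%MM.
  by apply/mnmP => j; rewrite mnmDE !mulmnE mulnDr.
have congrMn u e : congr u (U_(ord0) *+ wt u)%MM ->
    congr (u *+ e)%MM (U_(ord0) *+ wt (u *+ e))%MM.
  move=> cu; elim: e => [|e IHe]; first by rewrite mulm0n wt0 mulm0n.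
  by rewrite mulmS wtD mulmDn; apply: congrD.
(* Induction on the index: one doubling replaces a variable by the square of the preceding one. *)
have congrU n i : i = n :> nat -> congr U_(i)%MM (U_(ord0) *+ wt U_(i))%MM.
  elim: n i => [|n IHn] i def_i.
    by rewrite wt1 def_i mulm1n (_ : i = ord0) //; apply: val_inj.
  have lt_nk : (n < k)%N by rewrite -ltnS -def_i.
  pose n' := Ordinal lt_nk; have eq_i : i = lift ord0 n' by apply: val_inj.
  have -> : wt U_(i)%MM = wt (U_(widen_ord (leqnSn k) n') *+ 2)%MM.
    by rewrite wtMn !wt1 def_i expnS mulnC.
  apply: congr_trans (congrMn _ 2 (IHn _ _)) => //.
  by apply: ideal_gen_mem; exists n'; rewrite eq_i.
rewrite -/(congr _ _) [w]multinomUE_id.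
apply: (big_ind (fun u => congr u (U_(ord0) *+ wt u)%MM)) => [|u v cu cv|i _].
- by rewrite wt0 mulm0n.
- by rewrite wtD mulmDn; apply: congrD.
exact/congrMn/congrU.
Qed.

(** Two monomials of equal weight reduce to the same power of the variable [ord0]. *)
Lemma doublings_generate : binomial_generating_set I doublings.
Proof.
split=> [_ [i ->]|p].
  by exists U_(lift ord0 i)%MM, (U_(widen_ord (leqnSn k) i) *+ 2)%MM.
split; first by apply: ideal_gen_min => _ [i ->]; apply: toric_doubling.
apply: ideal_gen_min => _ [u [v [eq_deg ->]]].
have /toric_mbinomialE eq_wt : I (mbinomial K u v).
  by apply: ideal_gen_mem; exists u, v.
have -> : mbinomial K u v =
    mbinomial K u (U_(ord0) *+ wt u) - mbinomial K v (U_(ord0) *+ wt v).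
  by rewrite /mbinomial eq_wt opprB addrA subrK.
by apply: ideal_genD; [|apply: ideal_genN]; apply: doublings_reduce.
Qed.

(* At the point (0,...,0,1,...,1) whose first 1 is at index i+1, all the
   generators vanish except the i-th. *)
Lemma doublings_markov : markov_basis I doublings.
Proof.
split=> [|T sTM [_ genT] _ [i ->]]; first exact: doublings_generate.
have [s Ts def_i] : ideal_gen T (doubling i) by apply/genT/toric_doubling.
have [/hasP[c s_c /eqP <-]|/hasPn no_i] :=
    boolP (has (fun c => c.2 == doubling i) s).
  exact: Ts.
pose x (j : 'I_k.+1) : K := (i < j)%:R.
have eval_x (j : 'I_k) : (doubling j).@[x] = (j == i)%:R.
  rewrite /doubling /mbinomial -mpolyXn mevalB rmorphXn /= !mevalXU /x /= /bump.
  rewrite add1n ltnS -val_eqE /= expr2 -natrM mulnb andbb.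
  by case: ltngtP => _; rewrite ?subrr ?subr0.
have /eqP := eval_x i; rewrite eqxx def_i rmorph_sum big_seq big1 => [|c s_c].
  by rewrite eq_sym oner_eq0.
have [j def_c] := sTM _ (Ts _ s_c); rewrite rmorphM /= def_c eval_x.
case: eqP => [eq_ji|_]; last by rewrite mulr0.
by case/negP: (no_i _ s_c); rewrite def_c eq_ji.
Qed.

Lemma doublings_maxdeg : (0 < k)%N -> is_maxdeg doublings 2.
Proof.
move=> k_gt0.
have pdeg_doubling (i : 'I_k) : pdeg (doubling i) = 2.
  rewrite pdeg_mbinomial ?mdegMn ?mdeg1 //.
  by apply/eqP => /(congr1 mdeg); rewrite mdegMn !mdeg1.
split=> [|_ [i ->]]; last by rewrite pdeg_doubling.
by exists (doubling (Ordinal k_gt0)) => //; exists (Ordinal k_gt0).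
Qed.

(** * The binomial attaining the bound, as Graver element and circuit *)

Definition long_binomial : {mpoly K[k.+1]} :=
  mbinomial K U_(ord_max) (U_(ord0) *+ 2 ^ k).

Hypothesis k_gt0 : (0 < k)%N.

Lemma ord0_neq_max : ord0 != ord_max :> 'I_k.+1.
Proof. by rewrite -val_eqE /= eq_sym -lt0n. Qed.

Lemma long_binomial_neq : (U_(ord_max) != U_(ord0) *+ 2 ^ k :> 'X_{1..k.+1})%MM.
Proof.
apply/eqP => /mnmP/(_ ord_max); rewrite mulmnE !mnm1E eqxx.
by rewrite (negPf ord0_neq_max).
Qed.

Lemma wt_long_binomial :
  wt U_(ord_max : 'I_k.+1)%MM = wt (U_(ord0 : 'I_k.+1) *+ 2 ^ k)%MM.
Proof. by rewrite wtMn !wt1 mul1n. Qed.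

Lemma toric_long_binomial : I long_binomial.
Proof. exact/toric_mbinomial/wt_long_binomial. Qed.

Lemma pdeg_long_binomial : pdeg long_binomial = (2 ^ k)%N.
Proof.
rewrite pdeg_mbinomial ?long_binomial_neq // mdegMn !mdeg1 mul1n.
by apply/maxn_idPr; rewrite expn_gt0.
Qed.

(* The change of variables x_k |-> x_k + x_0^(2^k) turns x_k - x_0^(2^k) into
   the variable x_k, whose factorizations are read off degrees. *)
Lemma long_binomial_irreducible : irreducible_elt long_binomial.
Proof.
(* The parameter [a] lets [shift (-1)] serve as the inverse of [shift 1]. *)
pose shift (a : {mpoly K[k.+1]}) :=
  [tuple if i == ord_max then 'X_i + a * 'X_ord0 ^+ (2 ^ k) else 'X_i | i < k.+1].
have shift0 a : 'X_ord0 \mPo shift a = 'X_ord0.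
  by rewrite comp_mpoly_var tnth_mktuple (negPf ord0_neq_max).
have shift_max a : 'X_ord_max \mPo shift a = 'X_ord_max + a * 'X_ord0 ^+ (2 ^ k).
  by rewrite comp_mpoly_var tnth_mktuple eqxx.
have shiftK p : (p \mPo shift 1) \mPo shift (-1) = p.
  apply: comp_mpolyK => i; rewrite tnth_mktuple; case: eqP => [->|/eqP neq_i].
    by rewrite mul1r rmorphD rmorphXn /= shift0 shift_max mulN1r subrK.
  by rewrite comp_mpoly_var tnth_mktuple (negPf neq_i).
have unit_shift p : msize (p \mPo shift 1) = 1%N -> p \is a GRing.unit.
  move/eqP/msize_poly1P => [c nz_c def_c].
  by rewrite -[p]shiftK def_c comp_mpolyC; apply: unit_mpolyC.
have shift_long : long_binomial \mPo shift 1 = 'X_ord_max.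
  rewrite /long_binomial /mbinomial -mpolyXn rmorphB rmorphXn /= shift0 shift_max.
  by rewrite mul1r addrK.
split=> [||q r def_qr]; first by rewrite mbinomial_eq0 long_binomial_neq.
  exact/toric_nonunit/toric_long_binomial.
have /(congr1 (fun p => msize p)) := shift_long.
rewrite def_qr rmorphM /= msizeX mdeg1.
have [->|nz_q] := eqVneq (q \mPo shift 1) 0; first by rewrite mul0r msize0.
have [->|nz_r] := eqVneq (r \mPo shift 1) 0; first by rewrite mulr0 msize0.
(* A variable has [msize] 2, and the [msize] of a nonzero product is the sum of the two minus 1, so
   one factor has [msize] 1: a nonzero constant. *)
rewrite msizeM //; move: nz_q nz_r; rewrite -!msize_poly_eq0.
case def_a: (msize (q \mPo shift 1)) => [|[|a]] // _.
  by left; apply: unit_shift.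
case def_b: (msize (r \mPo shift 1)) => [|[|b]] // _.
  by right; apply: unit_shift.
by rewrite !addSn !addnS.
Qed.

(** The first monomial is a variable, so [w] is 1 or that variable. In the first case [z] has weight
    0 and equals [w]; in the second [z] divides a monomial of its own weight. *)
Lemma graver_long_binomial : graver I long_binomial.
Proof.
exists U_(ord_max)%MM, (U_(ord0) *+ 2 ^ k)%MM; split=> //.
- exact: long_binomial_irreducible.
- exact: toric_long_binomial.
move=> w z neq_wz /toric_mbinomialE eq_wt le_w le_z.
have [w0|nz_w] := eqVneq w 0%MM.
  case/eqP: neq_wz; rewrite w0; apply/esym/eqP.
  by rewrite -wt_eq0 -eq_wt w0 wt0.
have [|i w_i] := @mnm_neq0 w; first by rewrite wt_eq0.
have eq_w : w = U_(ord_max)%MM.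
  apply: lem_antisym => //; move: w_i; rewrite lep1mP.
  have := mnm_lepP le_w i; rewrite mnm1E; case: eqP => [<-//|_].
  by rewrite leqn0 => ->.
rewrite -eq_w; congr (_, _); apply: wt_le_inj => //.
by rewrite -eq_wt eq_w wt_long_binomial.
Qed.

(** A strictly smaller support leaves at most one variable, and two powers of one variable with
    equal weights coincide. *)
Lemma circuit_long_binomial : circuit I long_binomial.
Proof.
split; first by exists U_(ord_max)%MM, (U_(ord0) *+ 2 ^ k)%MM.
- exact: long_binomial_irreducible.
- exact: toric_long_binomial.
move=> _ [w [z ->]]; rewrite mbinomial_eq0 => neq_wz /toric_mbinomialE eq_wt.
apply/negP => /properP[/subsetP sub [x supp_x nsupp_x]].
have supp_ends l : l \in var_support long_binomial ->
    (l == ord_max) || (l == ord0).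
  rewrite mem_var_support ?long_binomial_neq // mulmnE !mnm1E ![_ == l]eq_sym.
  by case: (l == ord_max); case: (l == ord0).
(* Of the two variables of the support, [x] is missed and [y] is the other one. *)
have [y only_y] : exists y, forall l, l \in var_support long_binomial ->
    l != x -> l = y.
  case/orP: (supp_ends x supp_x) => /eqP->; [exists ord0 | exists ord_max] => l;
    by case/supp_ends/orP => /eqP->; rewrite ?eqxx.
have vanish l : l != y -> w l = 0%N /\ z l = 0%N.
  move=> neq_ly; have : l \notin var_support (mbinomial K w z).
    have [->//|neq_lx] := eqVneq l x.
    by apply: contraNN neq_ly => /sub/only_y->.
  by rewrite mem_var_support // negb_or !negbK => /andP[/eqP-> /eqP->].
have def_w := mnm_single (fun l neq_ly => (vanish l neq_ly).1).
have def_z := mnm_single (fun l neq_ly => (vanish l neq_ly).2).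
have : (w y * 2 ^ y = z y * 2 ^ y)%N.
  by move: eq_wt; rewrite {1}def_w {1}def_z !wtMn !wt1 ![(2 ^ _ * _)%N]mulnC.
move/eqP; rewrite eqn_pmul2r ?expn_gt0 // => /eqP eq_y.
by case/eqP: neq_wz; rewrite def_w def_z eq_y.
Qed.

(* Elimination order: the total degree in the variables other than x_0 is
   compared first, so that each x_i beats x_0^(2^i). *)
Definition hdeg u : nat := \sum_(i | i != ord0) u i.

Definition elim_le : rel 'X_{1..k.+1} := fun u v =>
  (hdeg u < hdeg v)%N || (hdeg u == hdeg v) && (u <= v)%O.

Lemma hdegD u v : hdeg (u + v)%MM = (hdeg u + hdeg v)%N.
Proof. by rewrite /hdeg -big_split; apply: eq_bigr => i _; rewrite mnmDE. Qed.

Lemma elim_le_order : monomial_order elim_le.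
Proof.
rewrite /elim_le; split=> [u v|u v|v u w|u|u v w].
- by case: ltngtP => //= _; apply: le_total.
- by case: ltngtP => //= _; apply: le_anti.
- case: (ltngtP (hdeg u)) => //= [lt_uv _|->].
    case: (ltngtP (hdeg v)) => //= [lt_vw _|<- _]; last by rewrite lt_uv.
    by rewrite (ltn_trans lt_uv lt_vw).
  by case: ltngtP => //= _; apply: le_trans.
- rewrite le0m andbT orbC -leq_eqVlt {1}/hdeg big1 // => i _.
  by rewrite mnm0E.
- by rewrite !hdegD ltn_add2r eqn_add2r lemc_add2l.
Qed.

Lemma hdegU i : hdeg U_(i)%MM = (i != ord0).
Proof.
have [->|neq_i0] := eqVneq i ord0.
  by rewrite /hdeg big1 // => j neq_j; rewrite mnm1E eq_sym (negPf neq_j).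
rewrite /hdeg (bigD1 i) //= mnm1E eqxx big1 // => j /andP[_ neq_ji].
by rewrite mnm1E eq_sym (negPf neq_ji).
Qed.

Lemma hdeg_eq0 u : hdeg u = 0%N -> u = (U_(ord0) *+ u ord0)%MM.
Proof.
move/eqP; rewrite /hdeg sum_nat_eq0 => /forall_inP u0.
by apply: mnm_single => i /u0/eqP.
Qed.

Lemma hdeg_ord0 e : hdeg (U_(ord0) *+ e)%MM = 0%N.
Proof.
rewrite /hdeg big1 // => i neq_i0.
by rewrite mulmnE mnm1E eq_sym (negPf neq_i0).
Qed.

(** * The reduced Groebner basis for the elimination order *)

Definition elimination (i : 'I_k) : {mpoly K[k.+1]} :=
  mbinomial K U_(lift ord0 i) (U_(ord0) *+ 2 ^ i.+1).

Lemma elimination_neq (i : 'I_k) :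
  (U_(lift ord0 i) != U_(ord0) *+ 2 ^ i.+1 :> 'X_{1..k.+1})%MM.
Proof. by apply/eqP => /(congr1 hdeg); rewrite hdegU hdeg_ord0. Qed.

Lemma elimination_initial (i : 'I_k) :
  is_initial elim_le (elimination i) U_(lift ord0 i)%MM.
Proof.
split=> [|v]; rewrite mem_msupp_mbinomial ?elimination_neq ?eqxx //.
rewrite /elim_le => /predU1P[->|/eqP->]; first by rewrite eqxx lexx orbT.
by rewrite hdegU hdeg_ord0.
Qed.

Lemma toric_elimination (i : 'I_k) : I (elimination i).
Proof. by apply: toric_mbinomial; rewrite wtMn !wt1 mul1n. Qed.

(** If the initial monomial were a power of the variable [ord0], so would be its partner of equal
    weight, being smaller in the order; the two would then coincide. *)
Lemma toric_initial_hdeg p u : I p -> is_initial elim_le p u -> hdeg u != 0%N.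
Proof.
move=> Ip [p_u max_u]; apply/eqP => u0.
have [v p_v [neq_vu eq_wt]] := toric_balanced Ip p_u.
have v0 : hdeg v = 0%N.
  by move: (max_u v p_v); rewrite /elim_le u0 ltn0 /= => /andP[/eqP].
have def_u := hdeg_eq0 u0; have def_v := hdeg_eq0 v0.
move: eq_wt; rewrite def_u def_v !wtMn !wt1 !mul1n => eq_uv.
by case/eqP: neq_vu; rewrite def_u def_v eq_uv.
Qed.

(** The initial ideal is generated by all variables but [ord0], and these are the initial monomials
    of the eliminations. The tails are powers of the variable [ord0], so nothing is left to
    reduce. *)
Lemma elimination_reduced_groebner :
  reduced_groebner_basis elim_le I (codom elimination).
Proof.
have [_ anti _ _ _] := elim_le_order.
have GI g : g \in codom elimination -> I g.
  by case/codomP=> i ->; apply: toric_elimination.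
split; first (split=> // q; split).
- apply: ideal_gen_min => _ [p [u [/GI Ip lead_u ->]]].
  by apply: ideal_gen_mem; exists p, u.
- apply: ideal_gen_min => _ [p [u [Ip lead_u ->]]].
  have : hdeg u != 0%N := toric_initial_hdeg Ip lead_u.
  rewrite /hdeg sum_nat_eq0 negb_forall_in => /exists_inP[i neq_i0].
  case: (unliftP ord0 i) neq_i0 => [i' ->|->] // _; rewrite -lep1mP => /submK <-.
  rewrite mpolyXD; apply/ideal_genM/ideal_gen_mem.
  exists (elimination i'), U_(lift ord0 i')%MM; split=> //.
    exact: codom_f.
  exact: elimination_initial.
- move=> _ /codomP[i ->]; exists U_(lift ord0 i)%MM.
    exact: elimination_initial.
  rewrite mcoeffB !mcoeffX eqxx eq_sym.
  by rewrite (negPf (elimination_neq i)) subr0.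
move=> _ _ u v /codomP[i ->] /codomP[j ->] neq_ij lead_u.
rewrite -(is_initial_inj anti (elimination_initial i) lead_u).
rewrite mem_msupp_mbinomial ?elimination_neq // lep1mP negbK.
case/predU1P=> [->|/eqP->]; last by rewrite mulmnE mnm1E.
rewrite mnm1E (inj_eq lift_inj); have [eq_ji|//] := eqVneq j i.
by rewrite eq_ji eqxx in neq_ij.
Qed.

Lemma universal_long_binomial : universal_groebner I long_binomial.
Proof.
exists elim_le, (codom elimination); split; first exact: elim_le_order.
  exact: elimination_reduced_groebner.
(* [elimination i] starts with the variable of index [i + 1], so the last variable corresponds to
   [k.-1]. *)
have lt_k : (k.-1 < k)%N by rewrite prednK.
apply/codomP; exists (Ordinal lt_k); rewrite /elimination /= prednK //.
rewrite (_ : lift _ _ = ord_max) //.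
by apply: val_inj; rewrite /= /bump add1n prednK.
Qed.

Lemma is_maxdeg_long_binomial (S : {mpoly K[k.+1]} -> Prop) :
    S long_binomial -> (forall p, S p -> (pdeg p <= 2 ^ k)%N) ->
  is_maxdeg S (2 ^ k).
Proof.
move=> Sl leS; split=> //.
by exists long_binomial; rewrite ?pdeg_long_binomial.
Qed.

End PowersOfTwo.

Theorem theorem3p12 (K : fieldType) (f : nat -> nat) :
  exists (n m : nat) (A : 'I_m -> 'rV[int]_n) (M : {mpoly K[m]} -> Prop)
         (dM dGr dU dC : nat),
    [/\ injective A,
        (forall (i : 'I_m) (j : 'I_n), 0 <= A i 0 j)
      & markov_basis (toric_ideal K A) M] /\
    [/\ is_maxdeg M dM,
        is_maxdeg (graver (toric_ideal K A)) dGr,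
        is_maxdeg (universal_groebner (toric_ideal K A)) dU
      & is_maxdeg (circuit (toric_ideal K A)) dC] /\
    [/\ (f dM < dGr)%N, (f dM < dU)%N & (f dM < dC)%N].
Proof.
(* The Markov degree is 2 for every positive [k], so it suffices that [2 ^ k] exceed [f 2]; the
   successor also makes [k] positive. *)
pose k := (f 2).+1; have k_gt0 : (0 < k)%N by [].
exists 1%N, k.+1, (@powers2 k), (@doublings K k).
exists 2, (2 ^ k)%N, (2 ^ k)%N, (2 ^ k)%N.
have lt_f : (f 2 < 2 ^ k)%N by rewrite (ltn_trans _ (ltn_expl k _)).
split; first split.
- move=> i j /matrixP/(_ 0 0); rewrite !mxE => -[/eqP].
  by rewrite eqn_exp2l // => /eqP/val_inj.
- by move=> i j; rewrite mxE.
- exact: doublings_markov.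
split=> //; split; first exact: doublings_maxdeg.
- apply: is_maxdeg_long_binomial (@graver_pdeg_le _ _) => //.
  exact: graver_long_binomial.
- apply: is_maxdeg_long_binomial (@universal_groebner_pdeg_le _ _) => //.
  exact: universal_long_binomial.
- apply: is_maxdeg_long_binomial (@circuit_pdeg_le _ _) => //.
  exact: circuit_long_binomial.
Qed.
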